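(* The compact space $2^\omega\times 2^{\omega_1}_{\mathrm{lex}}$ is pin homogeneous.
   Context: The space $2^\omega$ is the product of $\omega$ copies of the two-point discrete space. For an ordinal $\alpha$, $2^\alpha_{\mathrm{lex}}$ is the set of all functions $f\colon\alpha\to 2$ with the lexicographic ordering and the associated order topology (which is compact). The product carries the product topology. All spaces are assumed to be Hausdorff. Points $a,b$ in a compact space $X$ are pin equivalent (in $X$) if there exist a compact space $Y$, a continuous surjection $f\colon Y\to X$, and a homeomorphism $g\colon Y\to Y$ such that $g(f^{-1}\{a\})=f^{-1}\{b\}$. A compact space is pin homogeneous if every two of its points are pin equivalent. *)

(* Defs.v *)
From HB Require Import structures.
From mathcomp Require Import all_boot all_order.
From mathcomp Require Import all_classical wochoice topology cantor.

Set Implicit Arguments.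
Unset Strict Implicit.
Unset Printing Implicit Defensive.

Import Order.TTheory.

Local Open Scope classical_set_scope.
Local Open Scope order_scope.

HB.mixin Record Order_isWellOrder d (T : Type) & Order.Total d T := {
  le_well_order : well_order (<=%O : rel T)
}.

(* Ordinals are represented by well-ordered types. *)
#[short(type="wellOrderType")]
HB.structure Definition WellOrder d :=
  {T of Order.Total d T & Order_isWellOrder d T}.

(* W has order type omega_1: it is an uncountable well-order all of whose
   proper initial segments are countable. Such a W exists by [omega1_exists]. *)
Definition order_type_omega1 d (W : wellOrderType d) :=
  ~ countable [set: W] /\ forall x : W, countable [set y : W | y < x].

Definition lex2 (W : Type) : Type := W -> bool.

HB.instance Definition _ (W : Type) := Choice.on (lex2 W).

Section lex2_order.
Context d (W : wellOrderType d).
Implicit Types f g h : lex2 W.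

Definition lex2_lt f g : bool :=
  `[< exists i : W, (forall j : W, j < i -> f j = g j) /\ f i < g i >].

Lemma lex2_lt_irr : irreflexive lex2_lt.
Proof. by move=> f; apply/asboolP => -[i [_]]; rewrite ltxx. Qed.

Lemma lex2_lt_trans : transitive lex2_lt.
Proof.
move=> g f h /asboolP[i [fgE fgi]] /asboolP[k [ghE ghk]]; apply/asboolP.
case: (ltgtP i k) => [ik|ki|ik].
- by exists i; split=> [j ji|]; [rewrite fgE// ghE// (lt_trans ji)|rewrite -ghE].
- by exists k; split=> [j jk|]; [rewrite fgE ?ghE// (lt_trans jk)|rewrite fgE].
- exists i; split=> [j ji|]; first by rewrite fgE// ghE// -ik.
  by apply: lt_trans fgi _; rewrite ik.
Qed.

HB.instance Definition _ :=
  Order.Lt_isPOrder.Build d (lex2 W) lex2_lt_irr lex2_lt_trans.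

Lemma lex2_ltE f g :
  f < g = `[< exists i : W, (forall j : W, j < i -> f j = g j) /\ f i < g i >].
Proof. by []. Qed.

Lemma lex2_total : total (<=%O : rel (lex2 W)).
Proof.
move=> f g; have [->|/eqP fg] := eqVneq f g; first by rewrite lexx.
have [i fgi] : exists i, f i != g i.
  by apply/not_existsP => E; apply/fg/funext => i; apply/eqP/negPn/negP/E.
have [|m [[mfg mmin] _]] :=
  @le_well_order _ W [pred i | f i != g i]; first by exists i.
have E j : j < m -> f j = g j.
  by move=> jm; apply: contraTeq jm => jfg; rewrite -leNgt; exact: mmin.
case: (ltgtP (f m) (g m)) => [lt|lt|eq].
- by rewrite ltW// lex2_ltE; apply/asboolP; exists m.
- rewrite orbC ltW// lex2_ltE; apply/asboolP; exists m; split => // j jm.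
  by rewrite E.
- by move: mfg; rewrite inE eq eqxx.
Qed.

HB.instance Definition _ := Order.POrder_isTotal.Build d (lex2 W) lex2_total.

End lex2_order.

Definition homeomorphism (T U : topologicalType) (g : T -> U) :=
  exists h : U -> T,
    [/\ cancel g h, cancel h g, continuous g & continuous h].

Definition compact_hausdorff (X : topologicalType) :=
  compact [set: X] /\ hausdorff_space X.

Definition pin_equivalent (X : topologicalType) (a b : X) :=
  exists (Y : topologicalType) (f : Y -> X) (g : Y -> Y),
    [/\ compact_hausdorff Y, continuous f, range f = [set: X],
        homeomorphism g & g @` (f @^-1` [set a]) = f @^-1` [set b]].

Definition pin_homogeneous (X : topologicalType) :=
  compact_hausdorff X /\ forall a b : X, pin_equivalent a b.

(* The countable ordinals, realized inside a well-ordering of the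
   uncountable type nat -> bool. *)
Module Omega1.

Definition R : rel (nat -> bool) := sval (well_ordering_principle _).

Lemma R_wo : well_order R. Proof. exact: svalP. Qed.

Lemma R_wo_chain : wo_chain R predT. Proof. by move=> A _; exact: R_wo. Qed.

Lemma R_refl : reflexive R.
Proof. by move=> x; exact: (wo_chain_reflexive R_wo_chain). Qed.

Lemma R_anti : antisymmetric R.
Proof. by move=> x y; exact: (wo_chain_antisymmetric R_wo_chain). Qed.

Lemma R_total : total R.
Proof. by move=> x y; exact: (wo_chainW R_wo_chain). Qed.

Lemma R_trans : transitive R.
Proof.
move=> y x z xy yz.
have [|m [[]]] := @R_wo [pred t | t \in [:: x; y; z]].
  by exists x; rewrite !inE eqxx.
rewrite !inE => mE mmin _.
have mx : R m x by apply: mmin; rewrite !inE eqxx.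
have my : R m y by apply: mmin; rewrite !inE eqxx orbT.
have mz : R m z by apply: mmin; rewrite !inE eqxx !orbT.
case/or3P: mE => /eqP E; subst m => //.
- by rewrite (@R_anti x y) ?xy.
- by rewrite -(@R_anti y z) ?yz.
Qed.

Definition seg x : set (nat -> bool) := [set z | R z x].

Definition T : Type := {x : nat -> bool | countable (seg x)}.

HB.instance Definition _ := SubChoice.on T.

Definition le : rel T := fun x y => R (val x) (val y).

Lemma le_refl : reflexive le. Proof. by move=> x; exact: R_refl. Qed.

Lemma le_antisym : antisymmetric le.
Proof. by move=> x y xy; apply/val_inj/R_anti. Qed.

Lemma le_trans : transitive le. Proof. by move=> y x z; exact: R_trans. Qed.

Fact disp : Order.disp_t. Proof. exact: Order.Disp tt tt. Qed.

HB.instance Definition _ :=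
  Order.Le_isPOrder.Build disp T le_refl le_antisym le_trans.

Lemma le_total : total (<=%O : rel T).
Proof. by move=> x y; exact: R_total. Qed.

HB.instance Definition _ := Order.POrder_isTotal.Build disp T le_total.

Lemma le_wo : well_order (<=%O : rel T).
Proof.
apply: antisymmetric_well_order; first exact: le_anti.
move=> A [a aA].
have [|m [[]]] := @R_wo [pred x | `[< exists2 y, y \in A & val y = x >]].
  by exists (val a); apply/asboolP; exists a.
move=> /asboolP[y yA <-] ymin _; exists y; split=> // z zA.
by apply: ymin; apply/asboolP; exists z.
Qed.

HB.instance Definition _ := Order_isWellOrder.Build disp T le_wo.

Lemma uncountable_cantor : ~ countable [set: nat -> bool].
Proof.
move=> /countable_injP[f finj].
pose g n := `[< exists2 x, f x = n & x n = false >].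
case E : (g (f g)).
  have /asboolP[x fxg xE] := E.
  by move: xE; rewrite (finj x g) ?inE// E.
by have /asboolP := E; apply; exists g.
Qed.

Definition W : wellOrderType disp := T.

Lemma W_omega1 : order_type_omega1 W.
Proof.
split=> [Tc|x]; last first.
  have val_injT : {in [set y : T | y < x] &, injective (val : T -> _)}.
    by move=> y z _ _; exact: val_inj.
  rewrite -(eq_countable (inj_card_eq val_injT)).
  have xc : countable (seg (val x)) by exact: (proj2_sig x).
  apply: sub_countable xc.
  by apply: subset_card_le => _ [y yx <-]; exact: (ltW yx).
have Wc : countable [set x | countable (seg x)].
  apply: sub_countable Tc; apply: card_le_trans (card_image_le val _).
  by apply: subset_card_le => x xc; exists (exist _ x xc).
have [|m [[+ mmin] _]] := @R_wo [pred x | ~~ countable (seg x)].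
  apply: contrapT => E; apply: uncountable_cantor; apply: sub_countable Wc.
  apply: subset_card_le => x _ /=; apply: contrapT => xc.
  by apply: E; exists x; exact/negP.
move=> /negP; apply.
pose F (b : bool) := if b then [set x | countable (seg x)] else [set m].
apply: (@sub_countable _ _ _ (\bigcup_(b in [set: bool]) F b)).
  apply: subset_card_le => x xm /=; have [->|xNm] := eqVneq x m.
    by exists false.
  exists true => //=; apply: contrapT => xc; move/eqP: xNm; apply; apply: R_anti.
  by apply/andP; split=> //; apply: mmin; exact/negP.
by apply: bigcup_countable => // -[] _ //=; exact: countable1.
Qed.

End Omega1.

Lemma omega1_exists : exists d (W : wellOrderType d), order_type_omega1 W.
Proof. by exists Omega1.disp, Omega1.W; exact: Omega1.W_omega1. Qed.

(* Main.v *)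
Require Import Defs.
From HB Require Import structures.
From mathcomp Require Import all_boot all_order ssralg ssrint interval.
From mathcomp Require Import all_classical topology cantor.

(* Two points [a] and [b] are pin equivalent as soon as some closed relation
   with full projections relates [a] to [b] only and only [a] to [b]. Such a
   relation is the fibre product of two continuous maps from the space onto a
   common quotient whose fibres over some given point are [{a}] and [{b}]. Here
   the quotient is (omega + 1) x (omega_1 + 1) for every point (c, x): at least
   one of the two bits occurs uncountably often in [x], so [x] is approached from
   at least one side along omega_1; the other side has cofinality omega_1 too,
   and runs in parallel, or it is countable, in which case its neighbourhoods are
   merged with those of [c] in the Cantor space. *)

Set Implicit Arguments.
Unset Strict Implicit.
Unset Printing Implicit Defensive.

Import Order.TTheory.

Local Open Scope order_scope.
Local Open Scope classical_set_scope.

(** * Closed subspaces and spaces of bi-infinite orbits *)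

Lemma compact_hausdorff_set_type (X : topologicalType) (A : set X) :
  compact_hausdorff X -> closed A -> compact_hausdorff (set_type A).
Proof.
move=> [Xc Xh] Acl; split; last first.
  move=> p q clpq; apply: val_inj; apply: Xh => U V Up Vq.
  have [r [Ur Vr]] : (val @^-1` U) `&` (val @^-1` V : set (set_type A)) !=set0.
    by apply: clpq;
      exact: (@initial_continuous _ _ (set_val : set_type A -> X)).
  by exists (val r).
move=> F FF _.
(* The image of [F] in [X] has a cluster point, and it lies in [A] because [A] is closed and belongs
   to the image filter. *)
have [x [_ xF]] : [set: X] `&` cluster (fmap (val : set_type A -> X) F) !=set0.
  by apply: Xc; exact: filterT.
have xA : A x.
  apply: Acl => U Ux; apply: (xF A U _ Ux).
  by apply: (@filterE _ F) => y; exact: set_valP.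
exists (exist _ x (mem_set xA)); split=> // P Q FP [_ [[U oU <-] Ux UQ]].
have FimP : fmap (val : set_type A -> X) F (val @` P).
  by apply: (@filterS _ F _ P) FP => y Py; exists y.
have [_ [[y Py <-] Uy]] := xF _ _ FimP (open_nbhs_nbhs (conj oU Ux)).
by exists y; split=> //; apply: UQ.
Qed.

Section shift.
Context (X : topologicalType) (I : Type) (A B : I -> set X).
Hypothesis Xch : compact_hausdorff X.
Hypotheses (Acl : forall i, clopen (A i)) (Bcl : forall i, clopen (B i)).
Hypothesis AB : forall p, exists q, forall i, A i p <-> B i q.
Hypothesis BA : forall q, exists p, forall i, A i p <-> B i q.

Let Z : topologicalType := {ptws int -> X}.

Definition linked_orbits : set Z :=
  [set s | forall n i, A i (s n) <-> B i (s (n + 1)%R)].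

Let ev_continuous (n : int) : continuous (fun s : Z => s n).
Proof. exact: (@proj_continuous int (fun=> X) n). Qed.

Lemma closed_linked_orbits : closed linked_orbits.
Proof.
(* Each equivalence becomes both-or-neither, a closed condition on two coordinates because the sets
   are clopen. *)
rewrite (_ : linked_orbits = \bigcap_(k in [set: int * I])
    (((fun s : Z => s k.1) @^-1` A k.2 `&`
      (fun s : Z => s (k.1 + 1)%R) @^-1` B k.2) `|`
     (~` ((fun s : Z => s k.1) @^-1` A k.2) `&`
      ~` ((fun s : Z => s (k.1 + 1)%R) @^-1` B k.2)))).
  apply: closed_bigI => -[n i] _ /=.
  have An := preimage_clopen (Acl i) (@ev_continuous n).
  have Bn := preimage_clopen (Bcl i) (@ev_continuous (n + 1)%R).
  by apply: closedU; apply: closedI; case: An => ? ?; case: Bn => ? ? //;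
    exact: open_closedC.
apply/seteqP; split=> [s sL [n i] _ /=|s sL n i].
  have [sAB sBA] := sL n i; have [As|As] := pselect (A i (s n)); [left|right].
    by split=> //; exact: sAB.
  by split=> // /sBA.
have [[? ?]|[NA NB]] := sL (n, i) Logic.I; first by [].
by split=> [/NA|/NB].
Qed.

Lemma linked_orbit_through p : exists2 s, linked_orbits s & s 0%R = p.
Proof.
have [f fP] := choice AB; have [g gP] := choice BA.
(* Successors are chosen by [f] and predecessors by [g]. Since [Negz n] denotes [-(n+1)], it takes
   [n.+1] backward steps. *)
exists (fun n : int => match n with
  | Posz n => iter n f p | Negz n => iter n.+1 g p end) => //.
case=> n i; first by rewrite -PoszD addn1 /=; exact: fP.
case: n => [|n]; first exact: gP.
rewrite (_ : (Negz n.+1 + 1)%R = Negz n); first exact: gP.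
by rewrite !NegzE [in LHS]intS GRing.opprD GRing.addrAC GRing.addNr GRing.add0r.
Qed.

Definition shift_orbit (k : int) (s : Z) : Z := fun n => s (n + k)%R.

Lemma shift_orbit_continuous k : continuous (shift_orbit k).
Proof.
move=> s.
have FF : Filter (shift_orbit k @ s).
  by apply: fmap_filter; exact: (@nbhs_filter Z).
(* Convergence is tested one coordinate at a time; constant sequences show that evaluation is onto,
   as [cvg_image] demands. *)
apply/cvg_sup => n; apply/cvg_image => [|U Un].
  by rewrite eqEsubset; split=> // y _; exists (fun=> y).
have Uf : nbhs s ((fun s : Z => s (n + k)%R) @^-1` U) by exact: ev_continuous.
exists ((fun s : Z => s n) @^-1` U); first exact: Uf.
by rewrite image_preimage // eqEsubset; split=> // y _; exists (fun=> y).
Qed.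

Lemma shift_linked_orbits k s :
  linked_orbits s -> linked_orbits (shift_orbit k s).
Proof.
by move=> sL n i; have := sL (n + k)%R i; rewrite /shift_orbit GRing.addrAC.
Qed.

Let Y := set_type linked_orbits.
Let shift k (s : Y) : Y := exist _ (shift_orbit k (val s))
  (mem_set (shift_linked_orbits k (set_valP s))).

Let shift_continuous k : continuous (shift k).
Proof.
apply: continuous_comp_initial => s.
apply: (@continuous_comp Y Z Z set_val (shift_orbit k)).
  exact: initial_continuous.
exact: shift_orbit_continuous.
Qed.

(* The compact space witnessing pin equivalence is the space of bi-infinite
   orbits of the relation [forall i, A i p <-> B i q], moved by the shift: an
   orbit passes through [a] at time 0 iff it passes through [b] at time 1. *)
Lemma pin_equivalent_clopen_families a b :
  (forall p, (forall i, A i p) <-> p = a) ->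
  (forall q, (forall i, B i q) <-> q = b) -> pin_equivalent a b.
Proof.
move=> Aa Bb.
have at01 (s : Y) : val s 0%R = a <-> val s 1%R = b.
  rewrite -Aa -Bb; have sL i := set_valP s 0%R i; rewrite GRing.add0r in sL.
  by split=> H i; apply/sL.
exists Y, (fun s : Y => val s 0%R), (shift 1); split.
- apply: compact_hausdorff_set_type; last exact: closed_linked_orbits.
  split; last by apply: hausdorff_product => _; exact: Xch.2.
  have := @tychonoff int (fun=> X) (fun=> setT) (fun=> Xch.1).
  by congr (compact _); rewrite eqEsubset; split.
- move=> s; apply: (@continuous_comp Y Z X set_val (fun t : Z => t 0%R)).
    exact: initial_continuous.
  exact: ev_continuous.
- rewrite eqEsubset; split=> // p _.
  by have [s sL sp] := linked_orbit_through p; exists (exist _ s (mem_set sL)).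
- exists (shift (-1)); split; try exact: shift_continuous.
    move=> s; apply: val_inj; apply/funext => n.
    by rewrite /= /shift_orbit /= GRing.addrNK.
  move=> s; apply: val_inj; apply/funext => n.
  by rewrite /= /shift_orbit /= GRing.addrK.
- rewrite eqEsubset; split=> [_ [s /= sa <-]|t /= tb].
    by apply/at01.
  (* At time 1 this orbit has the value of [t] at time 0, which is [b]; hence it passes through [a]
     at time 0. *)
  exists (shift (-1) t).
    by apply/at01; rewrite /= /shift_orbit /= GRing.addrN.
  by apply: val_inj; apply/funext => n; rewrite /= /shift_orbit /= GRing.addrK.
Qed.

End shift.

(** * Clopen sets, countable unions and compact order topologies *)

Lemma clopen_forall_le (X : topologicalType) (A : nat -> set X) n :
  (forall k, clopen (A k)) -> clopen [set p | forall k, (k <= n)%N -> A k p].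
Proof.
move=> Acl; elim: n => [|n IHn].
  rewrite (_ : [set p | _] = A 0%N) //.
  by rewrite eqEsubset; split=> [p|p Ap [|k]] //; exact.
rewrite (_ : [set p | _] = [set p | forall k, (k <= n)%N -> A k p] `&` A n.+1).
  exact: clopenI.
rewrite eqEsubset; split=> [p Ap|p [Ap Anp] k].
  by split=> [k kn|]; apply: Ap => //; exact: leqW.
by rewrite leq_eqVlt => /predU1P[->|/Ap].
Qed.

Lemma countable_setU T (A B : set T) :
  countable A -> countable B -> countable (A `|` B).
Proof.
move=> Ac Bc.
rewrite (_ : A `|` B = \bigcup_(b in [set: bool]) if b then A else B).
  by apply: bigcup_countable => // -[].
rewrite eqEsubset; split=> [x [Ax|Bx]|x [[] _]]; [| |by left|by right].
  by exists true.
by exists false.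
Qed.

(** An ultrafilter [F] converges to the supremum [s] of those [a] whose closed upper ray is in [F].
    Rays above some [u < s] are in [F] by the choice of [s]; for [v > s] the closed upper ray of [v]
    is not in [F], so its complement is. *)
Lemma compact_order_topology d (T : orderType d) :
  (forall A : set T, exists s,
    (forall a, A a -> a <= s) /\ forall u, u < s -> exists2 a, A a & u < a) ->
  compact [set: order_topology T].
Proof.
move=> Tsup; rewrite compact_ultra => F FU _.
have FF : Filter F by exact: filter_filter.
have [s [sub slub]] := Tsup [set a : T | F [set y : order_topology T | a <= y]].
exists s; split=> // U; rewrite /= order_nbhs_itv => -[J [Jo sJ] JU].
apply: (@filterS _ F FF _ _ JU).
suff [Fl Fr] : (forall u : T, u < s -> F [set y : order_topology T | u < y]) /\
    (forall v : T, s < v -> F [set y : order_topology T | y < v]).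
  case: J Jo sJ {JU} => [[[]u|[]] [[]v|[]]] //= _; rewrite in_itv //= => suv.
  - case/andP: suv => us sv; have := @filterI _ F FF _ _ (Fl _ us) (Fr _ sv).
    by apply: (@filterS _ F FF) => y [? ?] /=; rewrite in_itv /=; apply/andP.
  - rewrite andbT in suv; have := Fl u suv.
    apply: (@filterS _ F FF) => y /= uy.
    by rewrite in_itv /= uy.
  - by have := Fr v suv; apply: (@filterS _ F FF) => y /= yv; rewrite in_itv.
  - by apply: (@filterE _ F FF) => y /=; rewrite in_itv.
split=> [u /slub[a Fa ua]|v sv].
  by apply: (@filterS _ F FF _ _ _ Fa) => y /= ay; exact: lt_le_trans ay.
have [Fv|] := in_ultra_setVsetC [set y : order_topology T | v <= y] FU.
  by have := sub _ Fv; rewrite leNgt sv.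
by apply: (@filterS _ F FF) => y /= /negP; rewrite -ltNge.
Qed.

(** * Well-orders and the regularity of omega_1 *)

Section well_order.
Context d (W : wellOrderType d).

Lemma wo_min (P : W -> Prop) :
  (exists x, P x) -> exists2 m, P m & forall y, P y -> m <= y.
Proof.
move=> [x Px].
have [|m [[+ mmin] _]] := @le_well_order _ W [pred y | `[< P y >]].
  by exists x; exact/asboolP.
by move=> /asboolP Pm; exists m => // y Py; apply: mmin; exact/asboolP.
Qed.

Lemma wo_ind (P : W -> Prop) :
  (forall x, (forall y, y < x -> P y) -> P x) -> forall x, P x.
Proof.
move=> IH x; apply: contrapT => nPx.
have [|m nPm mmin] := @wo_min (fun y => ~ P y); first by exists x.
apply: nPm; apply: IH => y ym; apply: contrapT => /mmin.
by rewrite leNgt ym.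
Qed.

Lemma wo_rec (T : Type) (F : W -> (W -> T) -> T) :
  (forall x f g, (forall y, y < x -> f y = g y) -> F x f = F x g) ->
  T -> exists f, forall x, f x = F x f.
Proof.
move=> Floc t0.
have wf : well_founded (fun y x : W => y < x).
  by apply: wo_ind => x IH; constructor.
(* The default [t0] extends a partial function to all of [W]; by [Floc] the result does not depend
   on it. *)
pose G x (r : forall y, y < x -> T) :=
  F x (fun y => if pselect (y < x) is left yx then r y yx else t0).
exists (Fix wf (fun=> T) G) => x; rewrite Fix_eq.
  by apply: Floc => y yx; case: pselect.
move=> {}x f g fg; apply: Floc => y yx; case: pselect => // ?; exact: fg.
Qed.

Lemma strictly_increasing_ge (e : W -> W) :
  {homo e : x y / x < y} -> forall x, x <= e x.
Proof.
move=> e_incr; apply: wo_ind => x IH; rewrite leNgt; apply/negP => ex.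
by have := IH _ ex; rewrite leNgt e_incr.
Qed.

Lemma down_closedP (P : W -> Prop) : (forall x y, x <= y -> P y -> P x) ->
  (forall x, P x) \/ exists b, forall x, P x <-> x < b.
Proof.
move=> Pdown; have [?|/existsNP/wo_min[b nPb bmin]] := pselect (forall x, P x).
  by left.
right; exists b => x; split=> [Px|xb].
  by rewrite ltNge; apply/negP => /Pdown/(_ Px).
by apply: contrapT => /bmin; rewrite leNgt xb.
Qed.

Section omega1.
Hypothesis hW : order_type_omega1 W.

Lemma omega1_countable_le (x : W) : countable [set y : W | y <= x].
Proof.
rewrite (_ : [set y | _] = [set y | y < x] `|` [set x]).
  by apply: countable_setU; [exact: hW.2|exact: countable1].
rewrite eqEsubset; split=> y /=; rewrite le_eqVlt.
  by move=> /predU1P[->|]; [right|left].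
by move=> [->|->]; rewrite ?eqxx ?orbT.
Qed.

(** A countable unbounded set would cover [W] by countably many countable initial segments. *)
Lemma omega1_countable_bounded (S : set W) :
  countable S -> exists b, forall x, S x -> x < b.
Proof.
move=> Sc; apply: contrapT => /forallNP Sunb; apply: hW.1.
apply: (@sub_countable _ _ _ (\bigcup_(s in S) [set y : W | y <= s])).
  apply: subset_card_le => b _; have /existsNP[s /not_implyP[Ss sb]] := Sunb b.
  by exists s => //=; rewrite leNgt; exact/negP.
by apply: bigcup_countable => // s _; exact: omega1_countable_le.
Qed.

Lemma omega1_increasing_in (S : set W) : ~ countable S ->
  exists2 e : W -> W, (forall x, S (e x)) & {homo e : x y / x < y}.
Proof.
move=> Sunc.
pose F x (f : W -> W) := xget x [set z | S z /\ forall y, y < x -> f y < z].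
have S0 : exists x, S x.
  apply: contrapT => /forallNP S0; apply: Sunc.
  by rewrite (_ : S = set0) // eqEsubset; split=> // x /S0.
have [|e eE] := @wo_rec W F _ (projT1 (cid S0)).
  move=> x f g fg; rewrite /F; congr xget; rewrite eqEsubset.
  by split=> z [Sz H]; split=> // y yx; have := H y yx; rewrite fg.
have eP x : S (e x) /\ forall y, y < x -> e y < e x.
  rewrite [e x]eE.
  apply: (@xgetPex _ x [set z | S z /\ forall y, y < x -> e y < z]).
  (* The earlier values are bounded by some [b]. If no element of [S] exceeded them all, [S] would
     lie below [b] and be countable. *)
  have [|b bP] := @omega1_countable_bounded (e @` [set y | y < x]).
    exact: sub_countable (card_image_le _ _) (hW.2 x).
  apply: contrapT => /forallNP H; apply: Sunc.
  apply: sub_countable (hW.2 b); apply: subset_card_le => z Sz /=.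
  rewrite ltNge; apply/negP => bz; apply: (H z); split=> // y yx.
  by apply: lt_le_trans bz; apply: bP; exists y.
by exists e => [x|x y xy]; [exact: (eP x).1|exact: (eP y).2].
Qed.

End omega1.
End well_order.

(** * The lexicographic order: suprema, jumps and clopen cuts *)

Section lex2.
Context d (W : wellOrderType d).
Implicit Types (f g x y : lex2 W) (i j k : W).

Definition first_diff f g i := f i != g i /\ forall j, j < i -> f j = g j.

Lemma first_diff_ex f g : f <> g -> exists i, first_diff f g i.
Proof.
move=> fg; have [|i fgi imin] := @wo_min _ W (fun i => f i != g i).
  apply: contrapT => /forallNP E; apply: fg; apply/funext => i.
  by apply/eqP/negPn/negP/E.
exists i; split=> // j ji; apply/eqP; apply: contraTT ji => /imin.
by rewrite leNgt.
Qed.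

Lemma lex2_ltP f g :
  f < g <-> exists i, [/\ first_diff f g i, f i = false & g i = true].
Proof.
rewrite lex2_ltE; split=> [/asboolP[i [E lt]]|[i [[_ E] fi gi]]].
  by exists i; move: lt; rewrite /first_diff; case: (f i) (g i) => -[].
by apply/asboolP; exists i; rewrite fi gi.
Qed.

(** The supremum is built by recursion: bit [i] is true when some member of [A] that agrees with the
    bits chosen before has a true bit there. For empty [A] this gives the least element, constantly
    false. *)
Lemma lex2_sup (A : set (lex2 W)) : exists s : lex2 W,
  (forall a, A a -> a <= s) /\ forall u, u < s -> exists2 a, A a & u < a.
Proof.
have [|s sE] := @wo_rec _ W bool (fun i s =>
    `[< exists2 a, A a & (forall j, j < i -> a j = s j) /\ a i >]) _ true.
  move=> i f g fg; congr asbool; apply/propext.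
  by split=> -[a Aa [E ai]]; exists a => //; split=> // j ji; rewrite E ?fg.
exists (s : lex2 W); split=> [a Aa|u /lex2_ltP[i [[_ us] ui]]].
  rewrite leNgt; apply/negP => /lex2_ltP[i [[_ E] + ai]].
  rewrite sE => /asboolPn; apply; exists a => //; split=> // j ji.
  by rewrite E.
rewrite sE => /asboolP[a Aa [E ai]]; exists a => //; apply/lex2_ltP.
exists i; rewrite /first_diff ui ai; split=> //; split=> // j ji.
by rewrite us ?E.
Qed.

Lemma compact_hausdorff_lex2 : compact_hausdorff (order_topology (lex2 W)).
Proof.
by split; [exact: compact_order_topology lex2_sup|exact: order_hausdorff].
Qed.

(** For [b] true and false these are the upper and lower ends of a jump, see [lex2_jump]. *)
Definition lex2_set x i (b : bool) : lex2 W :=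
  fun j => if j < i then x j else if j == i then b else ~~ b.

Lemma lex2_set_lt x i (b : bool) j : j < i -> lex2_set x i b j = x j.
Proof. by rewrite /lex2_set => ->. Qed.

Lemma lex2_set_eq x i (b : bool) : lex2_set x i b i = b.
Proof. by rewrite /lex2_set ltxx eqxx. Qed.

Lemma lex2_set_gt x i (b : bool) j : i < j -> lex2_set x i b j = ~~ b.
Proof. by move=> ij; rewrite /lex2_set ltNge ltW //= gt_eqF. Qed.

(** Beyond [i] the upper end has only false bits, so a smaller [y] must branch off at [i] or
    before. *)
Lemma lex2_lt_setP x i y : y < lex2_set x i true <->
  exists j, [/\ j <= i, first_diff y (lex2_set x i true) j & y j = false].
Proof.
split=> [/lex2_ltP[j [D yj uj]]|[j [ji D yj]]].
  exists j; split=> //; rewrite leNgt; apply/negP => ij.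
  by rewrite lex2_set_gt in uj.
by apply/lex2_ltP; exists j; split=> //; move: D.1; rewrite yj; case: lex2_set.
Qed.

Lemma lex2_set_ltP x i y : lex2_set x i false < y <->
  exists j, [/\ j <= i, first_diff y (lex2_set x i false) j & y j = true].
Proof.
split=> [/lex2_ltP[j [[D E] uj yj]]|[j [ji [D E] yj]]].
  exists j; split=> //; last first.
    by split=> [|k kj]; [rewrite eq_sym|rewrite E].
  rewrite leNgt; apply/negP => ij.
  by rewrite lex2_set_gt in uj.
apply/lex2_ltP; exists j; split=> //; last first.
  by move: D; rewrite yj; case: lex2_set.
by split=> [|k kj]; [rewrite eq_sym|rewrite E].
Qed.

(** A [y] strictly between the ends would leave the lower one at some [j <= i] with a true bit and
    the upper one at some [k <= i] with a false bit. The ends agree below [i], which forces [j = k],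
    a contradiction. *)
Lemma lex2_jump x i y : (y < lex2_set x i true) = ~~ (lex2_set x i false < y).
Proof.
have lu : lex2_set x i false < lex2_set x i true.
  apply/lex2_ltP; exists i; rewrite /first_diff !lex2_set_eq; split=> //.
  by split=> // j ji; rewrite !lex2_set_lt.
apply/idP/idP => [yu|]; last first.
  by rewrite -leNgt => /le_lt_trans; exact.
apply/negP => /lex2_set_ltP[j [ji [D E] yj]].
suff : lex2_set x i true <= y by rewrite leNgt yu.
rewrite leNgt; apply/negP => /lex2_ltP[k [[D' E'] yk uk]].
have [ik|ki] := ltP i k; first by rewrite lex2_set_gt in uk.
have [jk|kj|jk] := ltgtP j k.
- have ji' := lt_le_trans jk ki.
  by move: D; rewrite (E' j) // !lex2_set_lt // eqxx.
- have ki' := lt_le_trans kj ji.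
  by move: D'; rewrite (E k) // !lex2_set_lt // eqxx.
- by rewrite jk yk in yj.
Qed.

Lemma clopen_lt_lex2_set x i :
  clopen [set y : order_topology (lex2 W) | y < lex2_set x i true].
Proof.
rewrite (_ : [set _ | _] =
    `]-oo, (lex2_set x i true : order_topology _)[%classic).
  split; first exact: lray_open.
  rewrite (_ : `]-oo, _[%classic =
    `]-oo, (lex2_set x i false : order_topology (lex2 W))]%classic).
    exact: lray_closed.
  by rewrite eqEsubset; split=> y /=; rewrite !in_itv /= leNgt -lex2_jump.
by rewrite eqEsubset; split=> y /=; rewrite in_itv.
Qed.

(* If [x i] is true (resp. false), these are the [y] that are at least
   [x|i 1 0 0 ...] (resp. at most [x|i 0 1 1 ...]): a half-line cut at a jump,
   hence clopen. *)
Definition lex2_cut x i : set (lex2 W) :=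
  [set y | forall j, j <= i -> x j = x i -> ~ first_diff y x j].

Lemma first_diff_eq f g h i : (forall j, j <= i -> g j = h j) ->
  first_diff f g i <-> first_diff f h i.
Proof.
move=> gh; rewrite /first_diff gh //; split=> -[? E]; split=> // j ji;
by rewrite E // gh // ltW.
Qed.

Lemma lex2_set_id x i j : j <= i -> lex2_set x i (x i) j = x j.
Proof.
by rewrite le_eqVlt => /predU1P[->|/lex2_set_lt->//]; rewrite lex2_set_eq.
Qed.

Lemma first_diff_set_id f x i j : j <= i ->
  first_diff f (lex2_set x i (x i)) j <-> first_diff f x j.
Proof.
move=> ji; apply: first_diff_eq => k kj; apply: lex2_set_id.
exact: le_trans kj ji.
Qed.

Lemma first_diff_bit f x j b : first_diff f x j -> (x j = b) <-> (f j = ~~ b).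
Proof. by move=> [+ _]; case: (f j) (x j) b => -[] [] //=. Qed.

Lemma clopen_lex2_cut x i : @clopen (order_topology (lex2 W)) (lex2_cut x i).
Proof.
have [xi|xi] := boolP (x i); last have {}xi := negbTE xi.
  rewrite (_ : lex2_cut x i = ~` [set y | y < lex2_set x i true]).
    exact: (@clopenC _ _ setT (clopen_lt_lex2_set x i)).
  have fdE f j := @first_diff_set_id f x i j; rewrite xi in fdE.
  rewrite eqEsubset; split=> y /=; rewrite /lex2_cut /= xi.
    move=> cy /lex2_lt_setP[j [ji /fdE - /(_ ji) D yj]]; apply: (cy j) => //.
    by apply/(first_diff_bit _ D).
  move=> yu j ji xj D; apply: yu; apply/lex2_lt_setP; exists j; split=> //.
    exact/fdE.
  by apply/(first_diff_bit true D).
rewrite (_ : lex2_cut x i = [set y | y < lex2_set x i true]).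
  exact: clopen_lt_lex2_set.
have fdE f j := @first_diff_set_id f x i j; rewrite xi in fdE.
rewrite eqEsubset; split=> y /=; rewrite /lex2_cut /= xi lex2_jump.
  move=> cy; apply/negP=> /lex2_set_ltP[j [ji /fdE - /(_ ji) D yj]].
  by apply: (cy j) => //; apply/(first_diff_bit _ D).
move=> /negP yu j ji xj D; apply: yu; apply/lex2_set_ltP; exists j; split=> //.
  exact/fdE.
by apply/(first_diff_bit false D).
Qed.

Lemma lex2_cut_le x i j : i <= j -> x i = x j -> lex2_cut x j `<=` lex2_cut x i.
Proof.
move=> ij xij y cy k ki xki; apply: cy; first exact: le_trans ki ij.
by rewrite xki.
Qed.

Lemma lex2_cut_refl x i : lex2_cut x i x.
Proof. by move=> j _ _ [/eqP]. Qed.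

Lemma lex2_cut_first_diff x y i : first_diff y x i -> ~ lex2_cut x i y.
Proof. by move=> D /(_ i (lexx i) erefl). Qed.

Definition lex2_flip x i : lex2 W := fun j => if j == i then ~~ x j else x j.

Lemma first_diff_flip x i j : first_diff (lex2_flip x i) x j <-> j = i.
Proof.
rewrite /first_diff /lex2_flip; split=> [[+ _]|->].
  by have [//|_] := eqVneq j i; rewrite eqxx.
by rewrite eqxx; split=> [|k ki]; [case: (x i)|rewrite lt_eqF].
Qed.

(** A single flipped bit leaves exactly the cuts of its own bit value from that index on. Such
    points realize the proper initial segments of a chain of cuts without leaving any cut of the
    opposite value. *)
Lemma lex2_cut_flip x i j :
  lex2_cut x j (lex2_flip x i) <-> ~ (i <= j /\ x i = x j).
Proof.
split=> [cij [ij xij]|H k kj xkj /first_diff_flip E]; last first.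
  by apply: H; rewrite -E.
by apply: (cij i ij xij); exact/first_diff_flip.
Qed.

End lex2.

(** * Clopen families shrinking to a point of the lexicographic space *)

Section filtration.
Context d (W : wellOrderType d) (hW : order_type_omega1 W).
Let L := order_topology (lex2 W).

(** The cuts on one side of [x] are enumerated by [M] if they have countably many indices, and are
    replaced by a cofinal chain [N] of length omega_1 otherwise; the other family is then constantly
    the whole space. *)
Lemma lex2_cut_family (x : lex2 W) (b : bool) :
  exists (M : nat -> set L) (N : W -> set L),
  [/\ forall n, clopen (M n), forall i, clopen (N i),
      forall i j, i <= j -> N j `<=` N i,
      forall y, (forall i, x i = b -> lex2_cut x i y) ->
        (forall n, M n y) /\ (forall i, N i y) &
      forall y, (forall n, M n y) -> (forall i, N i y) ->
        forall i, x i = b -> lex2_cut x i y].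
Proof.
have [|/(omega1_increasing_in hW)[e eb e_incr]] :=
    pselect (countable [set i : W | x i = b]).
  move=> /countable_injP[g ginj].
  exists (fun n => [set y | forall i, x i = b -> g i = n -> lex2_cut x i y]).
  exists (fun=> setT); split=> //.
  - move=> n; have [[i [xi gi]]|Nn] := pselect (exists i, x i = b /\ g i = n).
      rewrite (_ : [set _ | _] = lex2_cut x i); first exact: clopen_lex2_cut.
      rewrite eqEsubset; split=> [y /= /(_ i xi gi)//|y cy j xj gj].
      by rewrite (ginj j i) ?inE // gj.
    rewrite (_ : [set _ | _] = setT); first exact: clopenT.
    by rewrite eqEsubset; split=> // y _ i xi gi; case: Nn; exists i.
  - by move=> i; exact: clopenT.
  - by move=> y H; split=> // n i xi _; exact: H.
  - by move=> y H _ i xi; exact: (H (g i)).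
exists (fun=> setT), (fun i => lex2_cut x (e i)); split=> //.
- by move=> i; exact: clopenT.
- by move=> i; exact: clopen_lex2_cut.
- move=> i j ij; apply: lex2_cut_le; last by rewrite !eb.
  by move: ij; rewrite le_eqVlt => /predU1P[->//|/e_incr/ltW].
- by move=> y H; split=> // i; apply: H; exact: eb.
- move=> y _ H i xi; apply: (lex2_cut_le _ _ (H i)); last by rewrite eb.
  exact: strictly_increasing_ge.
Qed.

Lemma lex2_filtration (x : L) : exists (M : nat -> set L) (N : W -> set L),
  [/\ (forall n, clopen (M n)) /\ (forall i, clopen (N i)),
      forall i j, i <= j -> N j `<=` N i,
      (forall n, M n x) /\ (forall i, N i x),
      forall y, (forall n, M n y) -> (forall i, N i y) -> y = x &
      forall j, exists2 y, forall n, M n y & forall i, N i y <-> i < j].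
Proof.
have [b bunc] : exists b, ~ countable [set i : W | x i = b].
  apply: contrapT => /forallNP H; apply: hW.1.
  rewrite (_ : [set: W] = [set i | x i = true] `|` [set i | x i = false]).
    by apply: countable_setU; apply: contrapT; exact: H.
  by rewrite eqEsubset; split=> // i _ /=; case: (x i); [left|right].
have [e eb e_incr] := omega1_increasing_in hW bunc.
have [M [N [Mcl Ncl Ndecr cMN MNc]]] := lex2_cut_family x (~~ b).
exists M, (fun i => lex2_cut x (e i) `&` N i); split.
- by split=> // i; apply: clopenI; [exact: clopen_lex2_cut|exact: Ncl].
- move=> i j ij y [cy Ny]; split; last exact: Ndecr ij _ Ny.
  apply: (lex2_cut_le _ _ cy); last by rewrite !eb.
  by move: ij; rewrite le_eqVlt => /predU1P[->//|/e_incr/ltW].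
- have [|? ?] := cMN x; first by move=> i _; exact: lex2_cut_refl.
  by split=> // i; split=> //; exact: lex2_cut_refl.
- move=> y My Ny; apply: contrapT => /first_diff_ex[j D].
  (* For the bit [b], the cut at [e j] is contained in the cut at [j] since [j <= e j]; the opposite
     bit is covered by [MNc]. *)
  apply: (lex2_cut_first_diff D); have [xj|xj] := eqVneq (x j) b.
    apply: (lex2_cut_le _ _ (Ny j).1); last by rewrite eb.
    exact: strictly_increasing_ge.
  apply: MNc => // [i|]; first exact: (Ny i).2.
  by move: xj; case: (x j); case: (b).
- move=> j; exists (lex2_flip x (e j)).
    apply: (cMN _ _).1 => i xi; apply/lex2_cut_flip => -[_].
    by rewrite eb xi; case: (b).
  move=> i; split=> [[/lex2_cut_flip H _]|ij].
    rewrite ltNge; apply/negP => ji; apply: H; rewrite !eb; split=> //.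
    by move: ji; rewrite le_eqVlt => /predU1P[->//|/e_incr/ltW].
  split; first by apply/lex2_cut_flip => -[]; rewrite leNgt e_incr.
  apply: (cMN _ _).2 => k xk; apply/lex2_cut_flip => -[_].
  by rewrite eb xk; case: (b).
Qed.

End filtration.

(** * The product with the Cantor space and its pin homogeneity *)

Section product.
Context d (W : wellOrderType d) (hW : order_type_omega1 W).
Let L := order_topology (lex2 W).
Let X : topologicalType := (cantor_space * L)%type.

Lemma clopen_cantor_coord n (b : bool) :
  clopen [set c : cantor_space | c n = b].
Proof.
have -> : [set c : cantor_space | c n = b] =
    (fun c : cantor_space => c n) @^-1` [set b] by [].
apply: preimage_clopen.
  by split; [exact: discrete_open|exact: discrete_closed].
exact: (@proj_continuous nat (fun=> bool) n).
Qed.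

(* [A] is a map onto (omega + 1) x (omega_1 + 1), ordinals being identified with
   their sets of predecessors: [p] goes to the pair of [{n | A (inl n) p}] and
   [{i | A (inr i) p}]. *)
Lemma product_filtration (a : X) : exists A : nat + W -> set X,
  [/\ forall i, clopen (A i),
      forall p, (forall i, A i p) <-> p = a,
      forall p m n, (m <= n)%N -> A (inl n) p -> A (inl m) p,
      forall p i j, i <= j -> A (inr j) p -> A (inr i) p &
      forall (P : nat -> Prop) (Q : W -> Prop),
        (forall m n, (m <= n)%N -> P n -> P m) ->
        (forall i j, i <= j -> Q j -> Q i) ->
        exists p, (forall n, A (inl n) p <-> P n) /\
          (forall i, A (inr i) p <-> Q i)].
Proof.
case: a => c x.
have [M [N [[Mcl Ncl] Ndecr [Mx Nx] MNx Nlt]]] := lex2_filtration hW x.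
(* The sets [M k] need not decrease, so stage [n] collects all [k <= n], together with the Cantor
   coordinates. *)
pose A (i : nat + W) : set X := match i with
  | inl n => [set p | forall k, (k <= n)%N -> p.1 k = c k /\ M k p.2]
  | inr i => [set p | N i p.2] end.
exists A; split.
- case=> [n|i]; last first.
    exact: (@preimage_clopen X L snd _ (Ncl i) (fun=> cvg_snd)).
  apply: (@clopen_forall_le X (fun k => [set p | p.1 k = c k /\ M k p.2])) => k.
  rewrite (_ : [set p : X | _] = fst @^-1` [set c' : cantor_space | c' k = c k]
    `&` snd @^-1` M k) //.
  apply: clopenI; apply: preimage_clopen => //.
  + exact: clopen_cantor_coord.
  + by move=> p; exact: cvg_fst.
  + by move=> p; exact: cvg_snd.
- move=> [c' y]; split=> [H|[-> ->] [n|i] //=].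
  congr pair; first by apply/funext => n; exact: (H (inl n) n (leqnn n)).1.
  by apply: MNx => [n|i]; [exact: (H (inl n) n (leqnn n)).2|exact: (H (inr i))].
- by move=> p m n mn Ap k km; apply: Ap; exact: leq_trans mn.
- by move=> p i j ij; exact: Ndecr.
- move=> P Q Pdown Qdown.
  have [c' c'P] : exists c' : cantor_space,
      forall n, (forall k, (k <= n)%N -> c' k = c k) <-> P n.
    have [PT|/existsNP[m0 nP]] := pselect (forall n, P n); first by exists c.
    have exP : exists n, `[< ~ P n >] by exists m0; exact/asboolP.
    have [m /asboolP nPm mmin] := ex_minnP exP.
    (* With [m] least outside [P], this agrees with [c] up to [n] exactly when [n < m]. The Cantor
       factor alone thus realizes [P], while [y] is kept in every [M n]. *)
    exists (fun k => if k == m then ~~ c k else c k) => n; split=> [E|Pn k kn].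
      apply: contrapT => /asboolP/mmin/E; rewrite eqxx.
      by case: (c m).
    by case: eqP => // km; case: nPm; apply: Pdown Pn; rewrite -km.
  have [y My yQ] : exists2 y, forall n, M n y & forall i, N i y <-> Q i.
    have [QT|[b bQ]] := down_closedP Qdown; first by exists x.
    have [y My yN] := Nlt b; exists y => // i.
    by rewrite yN bQ.
  exists (c', y); split=> // n; rewrite -c'P.
  by split=> [H k /H[]|H k /H].
Qed.

End product.

Theorem theorem6p10 (d : Order.disp_t) (W : wellOrderType d)
    (hW : order_type_omega1 W) :
  pin_homogeneous (cantor_space * order_topology (lex2 W))%type.
Proof.
have Xch : compact_hausdorff (cantor_space * order_topology (lex2 W))%type.
  have [Lc Lh] := compact_hausdorff_lex2 W; split.
    by rewrite -setXTT; apply: compact_setX => //; exact: cantor_space_compact.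
  move=> [c x] [c' x'] cl; congr pair.
    apply: cantor_space_hausdorff => U V Uc Vc'.
    have [||[p q] [[/= Up _] [/= Vp _]]] := cl (U `*` setT) (V `*` setT).
    - by exists (U, setT) => //=; split=> //; exact: filterT.
    - by exists (V, setT) => //=; split=> //; exact: filterT.
    by exists p.
  apply: Lh => U V Ux Vx'.
  have [||[p q] [[/= _ Uq] [/= _ Vq]]] := cl (setT `*` U) (setT `*` V).
  - by exists (setT, U) => //=; split=> //; exact: filterT.
  - by exists (setT, V) => //=; split=> //; exact: filterT.
  by exists q.
split=> // a b.
have [A [Acl Aa Anat AW Aex]] := product_filtration hW a.
have [B [Bcl Bb Bnat BW Bex]] := product_filtration hW b.
(* Membership patterns of either family are pairs of initial segments, and each such pair is
   realized by the other family, so the relation has full projections. *)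
apply: (pin_equivalent_clopen_families Xch Acl Bcl _ _ Aa Bb) => [p|q].
  have [q [qn qW]] := Bex _ _ (Anat p) (AW p).
  by exists q => -[n|i]; [rewrite qn|rewrite qW].
have [p [pn pW]] := Aex _ _ (Bnat q) (BW q).
by exists p => -[n|i]; [rewrite pn|rewrite pW].
Qed.
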